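(* Let $R$ and $S$ be unital associative rings and let $e\in R$ be an idempotent. Let ${}_{eRe}M_{S}$ and ${}_{S}N_{eRe}$ be bimodules defining a Morita equivalence $eRe\sim S$ (via surjective bimodule homomorphisms $\zeta\colon M\otimes_S N\to eRe$ and $\theta\colon N\otimes_{eRe}M\to S$ forming a Morita context). Then $$P=\begin{pmatrix}(1-e)R(1-e) & (1-e)Re\otimes_{eRe} M\\ eR(1-e) & M\end{pmatrix},\qquad Q=\begin{pmatrix}(1-e)R(1-e) & (1-e)Re\\ N\otimes_{eRe} eR(1-e) & N\end{pmatrix}$$ are, respectively, an $R$-$R'$-bimodule and an $R'$-$R$-bimodule, and they define a Morita equivalence $R\sim R'$, where $R'$ is the matrix ring $$R'=\begin{bmatrix}(1-e)R(1-e) & (1-e)Re\otimes_{eRe} M\\ N\otimes_{eRe} eR(1-e) & S\end{bmatrix}.$$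
   Context: Modules and bimodules over the unital rings here are unital. A Morita context $(A,B;\,U,V;\,\zeta,\theta)$ consists of rings $A,B$, bimodules ${}_AU_B$, ${}_BV_A$, an $A$-$A$-bimodule homomorphism $\zeta\colon U\otimes_B V\to A$ and a $B$-$B$-bimodule homomorphism $\theta\colon V\otimes_A U\to B$ such that $\zeta(u\otimes v)u'=u\,\theta(v\otimes u')$ and $\theta(v\otimes u)v'=v\,\zeta(u\otimes v')$ for all $u,u'\in U$, $v,v'\in V$. The bimodules $U,V$ are said to define a Morita equivalence $A\sim B$ if they are part of such a context with $\zeta$ and $\theta$ surjective; then $U\otimes_B-$ and $V\otimes_A-$ are mutually quasi-inverse equivalences between the categories of left $B$-modules and left $A$-modules. All additive groups of matrices have component-wise addition. The ring $R$ is identified with the matrix ring $\begin{bmatrix}(1-e)R(1-e) & (1-e)Re\\ eR(1-e) & eRe\end{bmatrix}$ via the Peirce decomposition. The multiplication of $R'$ and the actions of $R$ and $R'$ on $P$ and $Q$ are given by matrix multiplication, where products of entries are computed using the multiplication of $R$, the actions on $M$ and $N$, and the maps $\zeta,\theta$. Precisely, the products not already given by multiplication in $R$ or in $S$, or by the evident action on a tensor factor, are as follows, for $x\in (1-e)Re$ and $y\in eR(1-e)$ (or $y \in eRe$ where indicated), $m\in M$, $n\in N$: (a) $(x\otimes m)\cdot(n\otimes y)=x\,\zeta(m\otimes n)\,y\in(1-e)R(1-e)$; (b) $(n\otimes y)\cdot(x\otimes m)=\theta(n\,(yx)\otimes m)\in S$; (c) for the action of $R'$ on the right of the second row of $P$: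 $m\cdot(n\otimes y)=\zeta(m\otimes n)y\in eR(1-e)$, and $y\cdot (x\otimes m)=(yx)m\in M$; (d) for the action of $R'$ on the left of the second column of $Q$: $(x\otimes m)\cdot n=x\,\zeta(m\otimes n)\in (1-e)Re$, and $(n\otimes y)\cdot x=n(yx)\in N$; (e) for the action of $R$ on the left of the second column of $P$: $x\cdot m=x\otimes m$, and $y\cdot(x\otimes m)=(yx)m$; (f) for the action of $R$ on the right of the second row of $Q$: $n\cdot y=n\otimes y$, and $(n\otimes y)\cdot x=n(yx)$. *)

(* Defs.v *)
From HB Require Import structures.
From mathcomp Require Import all_boot all_algebra.
From mathcomp Require Import boolp freeg.

Set Implicit Arguments.
Unset Strict Implicit.
Unset Printing Implicit Defensive.

Import GRing.Theory.
Local Open Scope ring_scope.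

(* Rings are unital and associative, possibly zero ([pzRingType]): a corner   *)
(* ring [eRe] is the zero ring when [e = 0].                                  *)

Record ring_axioms (V : zmodType) (one : V) (mul : V -> V -> V) : Prop :=
  RingAxioms {
    ring_mulA : associative mul;
    ring_mul1l : left_id one mul;
    ring_mul1r : right_id one mul;
    ring_mulDl : left_distributive mul +%R;
    ring_mulDr : right_distributive mul +%R }.

Section RingOf.
Variables (V : zmodType) (one : V) (mul : V -> V -> V).

Definition ring_carrier (h : ring_axioms one mul) : Type := V.

Variable h : ring_axioms one mul.

HB.instance Definition _ := GRing.Zmodule.on (ring_carrier h).
HB.instance Definition _ := GRing.Zmodule_isPzRing.Build (ring_carrier h)
  (ring_mulA h) (ring_mul1l h) (ring_mul1r h) (ring_mulDl h) (ring_mulDr h).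

Definition ring_of : pzRingType := ring_carrier h.

End RingOf.

Definition left_module_axioms (A : pzRingType) (V : zmodType)
    (l : A -> V -> V) : Prop :=
  [/\ forall a, {morph l a : v w / v + w},
      forall v, {morph l^~ v : a b / a + b},
      forall a b v, l (a * b) v = l a (l b v)
    & forall v, l 1 v = v].

Definition right_module_axioms (B : pzRingType) (V : zmodType)
    (r : V -> B -> V) : Prop :=
  [/\ forall b, {morph r^~ b : v w / v + w},
      forall v, {morph r v : a b / a + b},
      forall v a b, r v (a * b) = r (r v a) b
    & forall v, r v 1 = v].

Definition bimodule_axioms (A B : pzRingType) (V : zmodType)
    (l : A -> V -> V) (r : V -> B -> V) : Prop :=
  [/\ left_module_axioms l, right_module_axioms r
    & forall a v b, r (l a v) b = l a (r v b)].

HB.mixin Record Zmodule_isBimodule (A B : pzRingType) (V : Type)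
    of GRing.Zmodule V := {
  lact : A -> V -> V;
  ract : V -> B -> V;
  bimodP : bimodule_axioms lact ract }.

#[short(type="bimodType")]
HB.structure Definition Bimodule (A B : pzRingType) :=
  {V of GRing.Zmodule V & Zmodule_isBimodule A B V}.

Reserved Notation "a *> v" (at level 40, left associativity).
Reserved Notation "v <* b" (at level 40, left associativity).
Notation "a *> v" := (lact a v) : ring_scope.
Notation "v <* b" := (ract v b) : ring_scope.

Section BimodOf.
Variables (A B : pzRingType) (V : zmodType).
Variables (l : A -> V -> V) (r : V -> B -> V).

Definition bimod_carrier (h : bimodule_axioms l r) : Type := V.

Variable h : bimodule_axioms l r.

HB.instance Definition _ := GRing.Zmodule.on (bimod_carrier h).
HB.instance Definition _ :=
  Zmodule_isBimodule.Build A B (bimod_carrier h) h.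

Definition bimod_of : bimodType A B := bimod_carrier h.

End BimodOf.

Section BimoduleTheory.
Variables (A B : pzRingType) (V : bimodType A B).
Implicit Types (v w : V).

Lemma lactDr (a : A) : {morph (fun v => a *> v) : v w / v + w}.
Proof. by case: (@bimodP A B V) => [[h _ _ _] _ _]; apply: h. Qed.
Lemma lactDl v : {morph (fun a : A => a *> v) : a b / a + b}.
Proof. by case: (@bimodP A B V) => [[_ h _ _] _ _]; apply: h. Qed.
Lemma lactA (a b : A) v : (a * b) *> v = a *> (b *> v).
Proof. by case: (@bimodP A B V) => [[_ _ h _] _ _]; apply: h. Qed.
Lemma lact1 v : (1 : A) *> v = v.
Proof. by case: (@bimodP A B V) => [[_ _ _ h] _ _]; apply: h. Qed.
Lemma ractDl (b : B) : {morph (fun v => v <* b) : v w / v + w}.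
Proof. by case: (@bimodP A B V) => [_ [h _ _ _] _]; apply: h. Qed.
Lemma ractDr v : {morph (fun b : B => v <* b) : a b / a + b}.
Proof. by case: (@bimodP A B V) => [_ [_ h _ _] _]; apply: h. Qed.
Lemma ractA v (a b : B) : v <* (a * b) = v <* a <* b.
Proof. by case: (@bimodP A B V) => [_ [_ _ h _] _]; apply: h. Qed.
Lemma ract1 v : v <* (1 : B) = v.
Proof. by case: (@bimodP A B V) => [_ [_ _ _ h] _]; apply: h. Qed.
Lemma lractA (a : A) v (b : B) : (a *> v) <* b = a *> (v <* b).
Proof. by case: (@bimodP A B V) => [_ _ h]; apply: h. Qed.

End BimoduleTheory.

Lemma regular_bimodP (A : pzRingType) :
  @bimodule_axioms A A A^o (fun a v => a * v) (fun v a => v * a).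
Proof.
split=> [||a v b]; last by rewrite mulrA.
  by split=> [a v w|v a b|a b v|v] /=; rewrite ?(mulrDl, mulrDr, mulrA, mul1r).
by split=> [b v w|v a b|v a b|v] /=; rewrite ?(mulrDl, mulrDr, mulrA, mulr1).
Qed.

HB.instance Definition _ (A : pzRingType) :=
  Zmodule_isBimodule.Build A A A^o (regular_bimodP A).

Section BimoduleHom.
Variables (A B : pzRingType) (U V : bimodType A B).

Record is_bimod_hom (f : U -> V) : Prop := IsBimodHom {
  bimod_homD : {morph f : u v / u + v};
  bimod_homl : forall (a : A) u, f (a *> u) = a *> f u;
  bimod_homr : forall u (b : B), f (u <* b) = f u <* b }.

End BimoduleHom.

Lemma morph_add0 (U V : zmodType) (f : U -> V) :
  {morph f : x y / x + y} -> f 0 = 0.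
Proof. by move=> fD; apply: (addrI (f 0)); rewrite -fD !addr0. Qed.

Lemma morph_addN (U V : zmodType) (f : U -> V) :
  {morph f : x y / x + y} -> {morph f : x / - x}.
Proof.
by move=> fD x; apply: (addrI (f x)); rewrite -fD !subrr morph_add0.
Qed.

Section GeneratedSubgroup.
Variables (V : zmodType) (G : V -> Prop).

Inductive in_subgroup : V -> Prop :=
  | in_subgroup0 : in_subgroup 0
  | in_subgroup_gen x : G x -> in_subgroup x
  | in_subgroupB x y : in_subgroup x -> in_subgroup y -> in_subgroup (x - y).

Definition subgroup_gen : {pred V} := fun x => `[< in_subgroup x >].

Lemma subgroup_gen_zmod_closed : zmod_closed subgroup_gen.
Proof.
split; first exact/asboolP/in_subgroup0.
by move=> x y /asboolP Gx /asboolP Gy; apply/asboolP/in_subgroupB.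
Qed.

HB.instance Definition _ :=
  GRing.isZmodClosed.Build V subgroup_gen subgroup_gen_zmod_closed.

End GeneratedSubgroup.

(* [U ⊗_B V]: the free abelian group on [U * V] modulo the subgroup generated *)
(* by the usual relators.                                                     *)
Section Tensor.
Variables (A B C : pzRingType) (U : bimodType A B) (V : bimodType B C).

Local Notation free := {freeg (U * V)%type / int}.

Inductive tensor_relator : free -> Prop :=
  | TensorDl u u' v :
      tensor_relator (<< (u + u', v) >> - << (u, v) >> - << (u', v) >>)
  | TensorDr u v v' :
      tensor_relator (<< (u, v + v') >> - << (u, v) >> - << (u, v') >>)
  | TensorA u (b : B) v :
      tensor_relator (<< (u <* b, v) >> - << (u, b *> v) >>).

Definition tensor : Type := Quotient.quot (subgroup_gen tensor_relator).

HB.instance Definition _ := GRing.Zmodule.on tensor.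

Definition tens (u : U) (v : V) : tensor :=
  \pi_(Quotient.quot (subgroup_gen tensor_relator))%qT << (u, v) >>.

End Tensor.

Arguments tensor {A B C} U V.
Arguments tens {A B C U V} u v.

Reserved Notation "u ⊗ v" (at level 40, left associativity).
Notation "u ⊗ v" := (tens u v) : ring_scope.

Section TensorLift.
Variables (A B C : pzRingType) (U : bimodType A B) (V : bimodType B C).
Variables (G : zmodType) (b : U -> V -> G).

Record balanced : Prop := Balanced {
  balancedDl : forall v, {morph b^~ v : u u' / u + u'};
  balancedDr : forall u, {morph b u : v v' / v + v'};
  balancedA : forall u (a : B) v, b (u <* a) v = b u (a *> v) }.

(* The additive map with [u ⊗ v |-> b u v]; meaningful for balanced [b], see  *)
(* [tlift_tens] and [tliftD].                                                 *)
Definition tlift (t : tensor U V) : G :=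
  fglift (fun p : (U * V)%type => b p.1 p.2 : zmodule G)
    (repr (t : Quotient.quot (subgroup_gen (tensor_relator (U:=U) (V:=V))))).

Hypothesis bB : balanced.

Local Notation lft := (fglift (fun p : (U * V)%type => b p.1 p.2 : zmodule G)).

Lemma tlift_pi x :
  tlift (\pi_(Quotient.quot (subgroup_gen (tensor_relator (U:=U) (V:=V))))%qT x)
    = lft x.
Proof.
rewrite /tlift; set y := repr _.
have := Quotient.idealrBE (subgroup_gen (tensor_relator (U:=U) (V:=V))) y x.
rewrite reprK eqxx => yxI; move/idP: yxI => /asboolP yxI.
have lB := lift_is_additive (fun p : (U * V)%type => b p.1 p.2 : zmodule G).
have l0 : lft 0 = 0 by rewrite -(subrr 0) lB subrr.
apply/eqP; rewrite -subr_eq0 -lB; apply/eqP.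
elim: (y - x) / yxI => [|z []|z1 z2 _ h1 _ h2]; first exact: l0.
- move=> u u' v; rewrite !lB !liftU !scale1r /= (balancedDl bB).
  by rewrite -addrA -opprD; apply: subrr.
- move=> u v v'; rewrite !lB !liftU !scale1r /= (balancedDr bB).
  by rewrite -addrA -opprD; apply: subrr.
- by move=> u a v; rewrite !lB !liftU !scale1r /= (balancedA bB); apply: subrr.
by rewrite lB h1 h2 subrr.
Qed.

Lemma tlift_tens u v : tlift (u ⊗ v) = b u v.
Proof. by rewrite /tens tlift_pi liftU scale1r. Qed.

Lemma tliftD : {morph tlift : s t / s + t}.
Proof.
have lB := lift_is_additive (fun p : (U * V)%type => b p.1 p.2 : zmodule G).
have lN x : lft (- x) = - lft x by rewrite -sub0r lB -(subrr 0) lB subrr sub0r.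
elim/quotW => x; elim/quotW => y.
by rewrite -raddfD !tlift_pi -{1}[y]opprK lB lN opprK.
Qed.

End TensorLift.

Section TensorTheory.
Variables (A B C : pzRingType) (U : bimodType A B) (V : bimodType B C).
Implicit Types (u : U) (v : V) (s t : tensor U V).

Lemma tensor_eq0 x : tensor_relator x ->
  \pi_(Quotient.quot (subgroup_gen (tensor_relator (U:=U) (V:=V))))%qT x = 0.
Proof.
move=> hx.
rewrite -(raddf0 \pi_(Quotient.quot (subgroup_gen (tensor_relator (U:=U) (V:=V))))%qT).
by apply/eqP; rewrite -Quotient.idealrBE subr0; apply/asboolP/in_subgroup_gen.
Qed.

Lemma tensDl v : {morph (fun u => u ⊗ v) : u u' / u + u'}.
Proof.
move=> u u'; apply/eqP; rewrite -subr_eq0 opprD addrA.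
by apply/eqP; have := tensor_eq0 (TensorDl u u' v); rewrite !raddfB.
Qed.

Lemma tensDr u : {morph (fun v => u ⊗ v) : v v' / v + v'}.
Proof.
move=> v v'; apply/eqP; rewrite -subr_eq0 opprD addrA.
by apply/eqP; have := tensor_eq0 (TensorDr u v v'); rewrite !raddfB.
Qed.

Lemma tensA u (b : B) v : (u <* b) ⊗ v = u ⊗ (b *> v).
Proof.
apply/eqP; rewrite -subr_eq0.
by apply/eqP; have := tensor_eq0 (TensorA u b v); rewrite raddfB.
Qed.

Lemma tensor_ind (P : tensor U V -> Prop) :
  (forall u v, P (u ⊗ v)) -> (forall s t, P s -> P t -> P (s + t)) ->
  forall t, P t.
Proof.
move=> Pt PD; elim/quotW.
have P0 : P 0 by rewrite -(morph_add0 (tensDl 0)); apply: Pt.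
have PN u v : P (- (u ⊗ v)) by rewrite -(morph_addN (tensDl v)); apply: Pt.
apply: freeg_ind_dom0 => [|k [u v] D _ _ PDD]; first by rewrite raddf0.
rewrite raddfD; apply: (PD) => //.
have -> : << k *g (u, v) >> = << (u, v) >> *~ k :> {freeg (U * V)%type / int}.
  by rewrite freegU_mulz intz.
rewrite raddfMz -/(tens u v).
have PM n t : P t -> P (t *+ n).
  by move=> Ptt; elim: n => [|n IHn] //; rewrite mulrS; apply: PD.
case: k => n; first by rewrite -pmulrn; apply/PM/Pt.
by rewrite NegzE mulrNz -pmulrn -mulNrn; apply/PM/PN.
Qed.

Lemma tensor_additive_eq (G : zmodType) (f g : tensor U V -> G) :
  {morph f : s t / s + t} -> {morph g : s t / s + t} ->
  (forall u v, f (u ⊗ v) = g (u ⊗ v)) -> f =1 g.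
Proof.
by move=> fD gD fg; apply: tensor_ind => // s t; rewrite fD gD => -> ->.
Qed.

Definition tensor_lact (a : A) : tensor U V -> tensor U V :=
  tlift (fun u v => (a *> u) ⊗ v).

Definition tensor_ract (t : tensor U V) (c : C) : tensor U V :=
  tlift (fun u v => u ⊗ (v <* c)) t.

Lemma balanced_lact (a : A) : balanced (fun u v => ((a *> u) ⊗ v)).
Proof.
split=> [v u u'|u v v'|u b v]; first by rewrite lactDr tensDl.
  by rewrite tensDr.
by rewrite -lractA tensA.
Qed.

Lemma balanced_ract (c : C) : balanced (fun u v => (u ⊗ (v <* c))).
Proof.
split=> [v u u'|u v v'|u b v]; first by rewrite tensDl.
  by rewrite ractDl tensDr.
by rewrite tensA lractA.
Qed.

Lemma tensor_bimodP : bimodule_axioms tensor_lact tensor_ract.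
Proof.
have lD a : {morph tensor_lact a : s t / s + t} := tliftD (balanced_lact a).
have lE a u v : tensor_lact a (u ⊗ v) = (a *> u) ⊗ v.
  exact: tlift_tens (balanced_lact a) u v.
have rD c : {morph tensor_ract^~ c : s t / s + t} := tliftD (balanced_ract c).
have rE c u v : tensor_ract (u ⊗ v) c = u ⊗ (v <* c).
  exact: tlift_tens (balanced_ract c) u v.
split; [split=> // [t a b|a b|] | split=> // [t a b|t a b|t] | move=> a t c].
- by elim/tensor_ind: t => [u v|s t hs ht];
    rewrite ?lE ?lactDl ?tensDl // !lD hs ht addrACA.
- by apply: tensor_ind => [u v|s t hs ht]; rewrite ?lE ?lactA // !lD hs ht.
- by apply: tensor_ind => [u v|s t hs ht]; rewrite ?lE ?lact1 // lD hs ht.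
- by elim/tensor_ind: t => [u v|s t hs ht];
    rewrite ?rE ?ractDr ?tensDr // !rD hs ht addrACA.
- by elim/tensor_ind: t => [u v|s t hs ht]; rewrite ?rE ?ractA // !rD hs ht.
- by elim/tensor_ind: t => [u v|s t hs ht]; rewrite ?rE ?ract1 // rD hs ht.
by elim/tensor_ind: t => [u v|s t hs ht];
  rewrite ?lE ?rE ?lE // !(lD, rD) hs ht.
Qed.

HB.instance Definition _ :=
  Zmodule_isBimodule.Build A C (tensor U V) tensor_bimodP.

Lemma lact_tens (a : A) u v : a *> (u ⊗ v) = (a *> u) ⊗ v.
Proof. exact: tlift_tens (balanced_lact a) u v. Qed.

Lemma ract_tens u v (c : C) : (u ⊗ v) <* c = u ⊗ (v <* c).
Proof. exact: tlift_tens (balanced_ract c) u v. Qed.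

End TensorTheory.

Section MoritaContext.
Variables (A B : pzRingType) (U : bimodType A B) (V : bimodType B A).

Record morita_context (zeta : tensor U V -> A) (theta : tensor V U -> B) :
    Prop := MoritaContext {
  morita_zeta : is_bimod_hom (zeta : tensor U V -> A^o);
  morita_theta : is_bimod_hom (theta : tensor V U -> B^o);
  morita_zetaA : forall u v u', zeta (u ⊗ v) *> u' = u <* theta (v ⊗ u');
  morita_thetaA : forall v u v', theta (v ⊗ u) *> v' = v <* zeta (u ⊗ v') }.

Definition surjective (T T' : Type) (f : T -> T') : Prop :=
  forall y, exists x, f x = y.

Definition morita_equivalence : Prop :=
  exists (zeta : tensor U V -> A) (theta : tensor V U -> B),
    [/\ morita_context zeta theta, surjective zeta & surjective theta].

End MoritaContext.

Record idem (R : pzRingType) :=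
  Idem { idem_val : R; idemM : idem_val * idem_val = idem_val }.

Lemma idemC_subproof (R : pzRingType) (e : idem R) :
  (1 - idem_val e) * (1 - idem_val e) = 1 - idem_val e.
Proof. by rewrite mulrBl mul1r mulrBr mulr1 idemM subrr subr0. Qed.

Definition idemC (R : pzRingType) (e : idem R) : idem R :=
  Idem (idemC_subproof e).

(* [peirce f g] is [fRg], see [in_peirceP].                                   *)
Section Peirce.
Variables (R : pzRingType) (f g : idem R).

Definition in_peirce : {pred R} := fun x => idem_val f * x * idem_val g == x.

Lemma in_peirceP x : reflect (exists r, x = idem_val f * r * idem_val g) (x \in in_peirce).
Proof.
apply: (iffP eqP) => [<-|[r ->]]; first by exists x.
by rewrite !mulrA idemM -!mulrA idemM.
Qed.

Lemma in_peirce_zmod_closed : zmod_closed in_peirce.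
Proof.
split=> [|x y /eqP hx /eqP hy]; apply/eqP; first by rewrite mulr0 mul0r.
by rewrite mulrBr mulrBl hx hy.
Qed.

HB.instance Definition _ :=
  GRing.isZmodClosed.Build R in_peirce in_peirce_zmod_closed.

Record peirce := Peirce { peirce_val : R; _ : peirce_val \in in_peirce }.

HB.instance Definition _ := [isSub for peirce_val].
HB.instance Definition _ := [Choice of peirce by <:].
HB.instance Definition _ := [SubChoice_isSubZmodule of peirce by <:].

Lemma peirceK (x : peirce) : idem_val f * val x * idem_val g = val x.
Proof. exact/eqP/(valP x). Qed.

Lemma peirce_of_subproof (r : R) : idem_val f * r * idem_val g \in in_peirce.
Proof. by apply/in_peirceP; exists r. Qed.

Definition peirce_of (r : R) : peirce := Peirce (peirce_of_subproof r).

End Peirce.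

Lemma peirce_mul_subproof (R : pzRingType) (f g h : idem R)
  (x : peirce f g) (y : peirce g h) : val x * val y \in in_peirce f h.
Proof.
apply/in_peirceP; exists (val x * val y).
by rewrite -(peirceK x) -(peirceK y) !mulrA idemM -!mulrA idemM.
Qed.

Definition peirce_mul (R : pzRingType) (f g h : idem R)
    (x : peirce f g) (y : peirce g h) : peirce f h :=
  Peirce (peirce_mul_subproof x y).

Reserved Notation "x ** y" (at level 40, left associativity).
Notation "x ** y" := (peirce_mul x y) : ring_scope.

Section PeirceTheory.
Variables (R : pzRingType).
Implicit Types (f g h k : idem R).

Lemma peirce_mulA f g h k (x : peirce f g) (y : peirce g h) (z : peirce h k) :
  x ** (y ** z) = x ** y ** z.
Proof. by apply: val_inj; rewrite /= mulrA. Qed.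

Lemma peirce_mulDl f g h (y : peirce g h) :
  {morph (fun x : peirce f g => x ** y) : x x' / x + x'}.
Proof. by move=> x x'; apply: val_inj; rewrite /= mulrDl. Qed.

Lemma peirce_mulDr f g h (x : peirce f g) :
  {morph (fun y : peirce g h => x ** y) : y y' / y + y'}.
Proof. by move=> y y'; apply: val_inj; rewrite /= mulrDr. Qed.

Definition peirce_one f : peirce f f := peirce_of f f 1.

Lemma val_peirce_one f : val (peirce_one f) = idem_val f.
Proof. by rewrite /= mulr1 idemM. Qed.

Lemma peirce_mul1l f g (x : peirce f g) : peirce_one f ** x = x.
Proof.
apply: val_inj; rewrite /= mulr1 idemM.
by rewrite -(peirceK x) !mulrA idemM.
Qed.

Lemma peirce_mul1r f g (x : peirce f g) : x ** peirce_one g = x.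
Proof.
apply: val_inj; rewrite /= mulr1 idemM.
by rewrite -(peirceK x) -!mulrA idemM.
Qed.

HB.instance Definition _ f := GRing.Zmodule_isPzRing.Build (peirce f f)
  (@peirce_mulA f f f f) (@peirce_mul1l f f) (@peirce_mul1r f f)
  (fun x y z => peirce_mulDl z x y) (@peirce_mulDr f f f).

Lemma peirce_bimodP f g :
  @bimodule_axioms (peirce f f) (peirce g g) (peirce f g)
    (fun a x => a ** x) (fun x b => x ** b).
Proof.
split; last by move=> a x b; rewrite peirce_mulA.
  split=> [a x y|x a b|a b x|x].
  - exact: peirce_mulDr.
  - exact: peirce_mulDl.
  - by rewrite peirce_mulA.
  - exact: peirce_mul1l.
split=> [b x y|x a b|x a b|x].
- exact: peirce_mulDl.
- exact: peirce_mulDr.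
- by rewrite peirce_mulA.
- exact: peirce_mul1r.
Qed.

HB.instance Definition _ f g :=
  Zmodule_isBimodule.Build (peirce f f) (peirce g g) (peirce f g)
    (peirce_bimodP f g).

End PeirceTheory.

(* [Mx2 a b c d] is the matrix with rows [(a, b)] and [(c, d)]; the addition  *)
(* is componentwise.                                                          *)
Definition mx2 (A B C D : Type) : Type := ((A * B) * (C * D))%type.

HB.instance Definition _ (A B C D : zmodType) :=
  GRing.Zmodule.on (mx2 A B C D).

Section Mx2.
Variables (A B C D : Type).

Definition Mx2 (a : A) (b : B) (c : C) (d : D) : mx2 A B C D :=
  ((a, b), (c, d)).

Definition m11 (x : mx2 A B C D) : A := x.1.1.
Definition m12 (x : mx2 A B C D) : B := x.1.2.
Definition m21 (x : mx2 A B C D) : C := x.2.1.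
Definition m22 (x : mx2 A B C D) : D := x.2.2.

End Mx2.

(* [R] acts on [Pmx] and [Qmx] through its Peirce decomposition: the entries  *)
(* of [peirce_mx e r] are the [f r g] for [f, g] in [1 - e, e].               *)
Definition peirce_mx (R : pzRingType) (e : idem R) (r : R) :
    mx2 (peirce (idemC e) (idemC e)) (peirce (idemC e) e)
        (peirce e (idemC e)) (peirce e e) :=
  Mx2 (peirce_of _ _ r) (peirce_of _ _ r) (peirce_of _ _ r) (peirce_of _ _ r).

(* Below, [x], [y], [m] and [n] range over [(1-e)Re], [eR(1-e)], [M] and [N]. *)
Section ReplaceCorner.
Variables (R S : pzRingType) (e : idem R).
Variables (M : bimodType (peirce e e) S) (N : bimodType S (peirce e e)).
Variables (zeta : tensor M N -> peirce e e) (theta : tensor N M -> S).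

Local Notation f := (idemC e).
Local Notation XM := (tensor (peirce f e) M).
Local Notation NY := (tensor N (peirce e f)).

(* [mul_xm_ny] is [(x ⊗ m)(n ⊗ y) = x ζ(m ⊗ n) y], etc.: these are only       *)
(* meaningful when [zeta] and [theta] are bimodule homomorphisms, and the     *)
(* values on pure tensors are given by the lemmas [mul_xm_nyE], etc.          *)
Definition mul_xm_ny (s : XM) (t : NY) : peirce f f :=
  tlift (fun x m => tlift (fun n y => x ** zeta (m ⊗ n) ** y) t) s.

Definition mul_ny_xm (t : NY) (s : XM) : S :=
  tlift (fun n y => tlift (fun x m => theta ((n <* (y ** x)) ⊗ m)) s) t.

Definition mul_m_ny (m : M) (t : NY) : peirce e f :=
  tlift (fun n y => zeta (m ⊗ n) ** y) t.

Definition mul_y_xm (y : peirce e f) (s : XM) : M :=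
  tlift (fun x m => (y ** x) *> m) s.

Definition mul_xm_n (s : XM) (n : N) : peirce f e :=
  tlift (fun x m => x ** zeta (m ⊗ n)) s.

Definition mul_ny_x (t : NY) (x : peirce f e) : N :=
  tlift (fun n y => n <* (y ** x)) t.

Section Formulas.
Hypothesis hctx : morita_context zeta theta.

Let zetaD : {morph zeta : s t / s + t} := bimod_homD (morita_zeta hctx).
Let zetal (a : peirce e e) m n : zeta ((a *> m) ⊗ n) = a ** zeta (m ⊗ n).
Proof. by rewrite -lact_tens; apply: (bimod_homl (morita_zeta hctx)). Qed.
Let zetar m n (a : peirce e e) : zeta (m ⊗ (n <* a)) = zeta (m ⊗ n) ** a.
Proof. by rewrite -ract_tens; apply: (bimod_homr (morita_zeta hctx)). Qed.
Let thetaD : {morph theta : s t / s + t} := bimod_homD (morita_theta hctx).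
Let thetal (s : S) n m : theta ((s *> n) ⊗ m) = s * theta (n ⊗ m).
Proof. by rewrite -lact_tens; apply: (bimod_homl (morita_theta hctx)). Qed.
Let thetar n m (s : S) : theta (n ⊗ (m <* s)) = theta (n ⊗ m) * s.
Proof. by rewrite -ract_tens; apply: (bimod_homr (morita_theta hctx)). Qed.

Lemma balanced_xm_ny (x : peirce f e) m :
  balanced (fun (n : N) (y : peirce e f) => x ** zeta (m ⊗ n) ** y).
Proof.
split=> [y n n'|n y y'|n a y].
- by rewrite tensDr zetaD peirce_mulDr peirce_mulDl.
- by rewrite peirce_mulDr.
- by rewrite zetar !peirce_mulA.
Qed.

Lemma balanced_xm_ny_l (t : NY) : balanced (fun (x : peirce f e) (m : M) =>
  tlift (fun (n : N) (y : peirce e f) => x ** zeta (m ⊗ n) ** y) t).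
Proof.
have bD x m := tliftD (balanced_xm_ny x m).
have bE x m := tlift_tens (balanced_xm_ny x m).
split=> [m x x'|x m m'|x a m]; elim/tensor_ind: t => [n y|s t hs ht];
  rewrite ?bD ?hs ?ht ?bE //; try by rewrite addrACA.
- by rewrite !peirce_mulDl.
- by rewrite tensDl zetaD peirce_mulDr peirce_mulDl.
- by rewrite zetal peirce_mulA.
Qed.

Lemma mul_xm_nyE x m n y :
  mul_xm_ny (x ⊗ m) (n ⊗ y) = x ** zeta (m ⊗ n) ** y.
Proof.
by rewrite /mul_xm_ny (tlift_tens (balanced_xm_ny_l _))
  (tlift_tens (balanced_xm_ny _ _)).
Qed.

Lemma mul_xm_nyDl t : {morph mul_xm_ny^~ t : s s' / s + s'}.
Proof. exact: tliftD (balanced_xm_ny_l t). Qed.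

Lemma mul_xm_nyDr s : {morph mul_xm_ny s : t t' / t + t'}.
Proof.
move=> t t'; elim/tensor_ind: s => [x m|s s' hs hs'].
  rewrite /mul_xm_ny !(tlift_tens (balanced_xm_ny_l _)).
  exact: tliftD (balanced_xm_ny _ _) t t'.
by rewrite !mul_xm_nyDl hs hs' addrACA.
Qed.

Lemma balanced_ny_xm n (y : peirce e f) :
  balanced (fun (x : peirce f e) (m : M) => theta ((n <* (y ** x)) ⊗ m)).
Proof.
split=> [m x x'|x m m'|x a m].
- by rewrite peirce_mulDr ractDr tensDl thetaD.
- by rewrite tensDr thetaD.
- by rewrite -tensA -ractA -[(y ** x) * a]/(y ** x ** a) peirce_mulA.
Qed.

Lemma balanced_ny_xm_l (s : XM) : balanced (fun (n : N) (y : peirce e f) =>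
  tlift (fun (x : peirce f e) (m : M) => theta ((n <* (y ** x)) ⊗ m)) s).
Proof.
have bD n y := tliftD (balanced_ny_xm n y).
have bE n y := tlift_tens (balanced_ny_xm n y).
split=> [y n n'|n y y'|n a y]; elim/tensor_ind: s => [x m|s t hs ht];
  rewrite ?bD ?hs ?ht ?bE //; try by rewrite addrACA.
- by rewrite ractDl tensDl thetaD.
- by rewrite peirce_mulDl ractDr tensDl thetaD.
- by rewrite -ractA -[a * _]/(a ** _) peirce_mulA.
Qed.

Lemma mul_ny_xmE n y x m :
  mul_ny_xm (n ⊗ y) (x ⊗ m) = theta ((n <* (y ** x)) ⊗ m).
Proof.
by rewrite /mul_ny_xm (tlift_tens (balanced_ny_xm_l _))
  (tlift_tens (balanced_ny_xm _ _)).
Qed.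

Lemma mul_ny_xmDl s : {morph mul_ny_xm^~ s : t t' / t + t'}.
Proof. exact: tliftD (balanced_ny_xm_l s). Qed.

Lemma mul_ny_xmDr t : {morph mul_ny_xm t : s s' / s + s'}.
Proof.
move=> s s'; elim/tensor_ind: t => [n y|t t' ht ht'].
  rewrite /mul_ny_xm !(tlift_tens (balanced_ny_xm_l _)).
  exact: tliftD (balanced_ny_xm _ _) s s'.
by rewrite !mul_ny_xmDl ht ht' addrACA.
Qed.

Lemma balanced_m_ny m :
  balanced (fun (n : N) (y : peirce e f) => zeta (m ⊗ n) ** y).
Proof.
split=> [y n n'|n y y'|n a y].
- by rewrite tensDr zetaD peirce_mulDl.
- by rewrite peirce_mulDr.
- by rewrite zetar !peirce_mulA.
Qed.

Lemma mul_m_nyE m n y : mul_m_ny m (n ⊗ y) = zeta (m ⊗ n) ** y.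
Proof. exact: tlift_tens (balanced_m_ny m) n y. Qed.

Lemma mul_m_nyDr m : {morph mul_m_ny m : t t' / t + t'}.
Proof. exact: tliftD (balanced_m_ny m). Qed.

Lemma balanced_xm_n n :
  balanced (fun (x : peirce f e) (m : M) => x ** zeta (m ⊗ n)).
Proof.
split=> [m x x'|x m m'|x a m].
- by rewrite peirce_mulDl.
- by rewrite tensDl zetaD peirce_mulDr.
- by rewrite zetal peirce_mulA.
Qed.

Lemma mul_xm_nE x m n : mul_xm_n (x ⊗ m) n = x ** zeta (m ⊗ n).
Proof. exact: tlift_tens (balanced_xm_n n) x m. Qed.

Lemma mul_xm_nDl n : {morph mul_xm_n^~ n : s s' / s + s'}.
Proof. exact: tliftD (balanced_xm_n n). Qed.

End Formulas.

Lemma balanced_y_xm (y : peirce e f) :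
  balanced (fun (x : peirce f e) (m : M) => (y ** x) *> m).
Proof.
split=> [m x x'|x m m'|x a m].
- by rewrite peirce_mulDr lactDl.
- by rewrite lactDr.
- by rewrite -lactA -[(y ** x) * a]/(y ** x ** a) peirce_mulA.
Qed.

Lemma mul_y_xmE y x m : mul_y_xm y (x ⊗ m) = (y ** x) *> m.
Proof. exact: tlift_tens (balanced_y_xm y) x m. Qed.

Lemma mul_y_xmDr y : {morph mul_y_xm y : s s' / s + s'}.
Proof. exact: tliftD (balanced_y_xm y). Qed.

Lemma balanced_ny_x (x : peirce f e) :
  balanced (fun (n : N) (y : peirce e f) => n <* (y ** x)).
Proof.
split=> [y n n'|n y y'|n a y].
- by rewrite ractDl.
- by rewrite peirce_mulDl ractDr.
- by rewrite -ractA -[a * _]/(a ** _) peirce_mulA.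
Qed.

Lemma mul_ny_xE n y x : mul_ny_x (n ⊗ y) x = n <* (y ** x).
Proof. exact: tlift_tens (balanced_ny_x x) n y. Qed.

Lemma mul_ny_xDl x : {morph mul_ny_x^~ x : t t' / t + t'}.
Proof. exact: tliftD (balanced_ny_x x). Qed.

Definition Rprime : Type := mx2 (peirce f f) XM NY S.
Definition Pmx : Type := mx2 (peirce f f) XM (peirce e f) M.
Definition Qmx : Type := mx2 (peirce f f) (peirce f e) NY N.

HB.instance Definition _ := GRing.Zmodule.on Rprime.
HB.instance Definition _ := GRing.Zmodule.on Pmx.
HB.instance Definition _ := GRing.Zmodule.on Qmx.

Definition Rprime_one : Rprime := Mx2 1 0 0 1.

Definition Rprime_mul (a b : Rprime) : Rprime :=
  Mx2 (m11 a * m11 b + mul_xm_ny (m12 a) (m21 b))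
      (m11 a *> m12 b + m12 a <* m22 b)
      (m21 a <* m11 b + m22 a *> m21 b)
      (mul_ny_xm (m21 a) (m12 b) + m22 a * m22 b).

Definition Pmx_lact (r : R) (p : Pmx) : Pmx :=
  let a := peirce_mx e r in
  Mx2 (m11 a ** m11 p + m12 a ** m21 p)
      (m11 a *> m12 p + m12 a ⊗ m22 p)
      (m21 a ** m11 p + m22 a ** m21 p)
      (mul_y_xm (m21 a) (m12 p) + m22 a *> m22 p).

Definition Pmx_ract (p : Pmx) (b : Rprime) : Pmx :=
  Mx2 (m11 p ** m11 b + mul_xm_ny (m12 p) (m21 b))
      (m11 p *> m12 b + m12 p <* m22 b)
      (m21 p ** m11 b + mul_m_ny (m22 p) (m21 b))
      (mul_y_xm (m21 p) (m12 b) + m22 p <* m22 b).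

Definition Qmx_lact (b : Rprime) (q : Qmx) : Qmx :=
  Mx2 (m11 b ** m11 q + mul_xm_ny (m12 b) (m21 q))
      (m11 b ** m12 q + mul_xm_n (m12 b) (m22 q))
      (m21 b <* m11 q + m22 b *> m21 q)
      (mul_ny_x (m21 b) (m12 q) + m22 b *> m22 q).

Definition Qmx_ract (q : Qmx) (r : R) : Qmx :=
  let a := peirce_mx e r in
  Mx2 (m11 q ** m11 a + m12 q ** m21 a)
      (m11 q ** m12 a + m12 q ** m22 a)
      (m21 q <* m11 a + m22 q ⊗ m21 a)
      (mul_ny_x (m21 q) (m12 a) + m22 q <* m22 a).

End ReplaceCorner.

(* Main.v *)
Require Import Defs.
From HB Require Import structures.
From mathcomp Require Import all_boot all_algebra.

Set Implicit Arguments.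
Unset Strict Implicit.
Unset Printing Implicit Defensive.

Import GRing.Theory.
Local Open Scope ring_scope.

(** Write [f = 1 - e], [X = fRe] and [Y = eRf]. Every block of [R],
[R'], [P] and [Q] is a morphism group of one preadditive category [corners]
with three objects, one for each of the rings [fRf], [eRe] and [S]:
<<
              f          e        S
      f      fRf         X      X ⊗ M
      e       Y         eRe       M
      S     N ⊗ Y        N        S
>>
The composition is the multiplication of entries. It is associative
([corner_compA]): [X ⊗ M] and [N ⊗ Y] are additively generated by composites
through the object [e], so it is enough to compare pure tensors, and on these
both bracketings reduce to the same word because of associativity in [R], the
bimodule axioms and the two identities linking [zeta] and [theta].

Block matrices over a preadditive category form a preadditive category whose
objects are pairs of objects ([matrices]). There [R] is the endomorphism ring of
the pair [(f, e)] by the Peirce decomposition ([peirce_end_iso]), [R'] is that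
of [(f, S)], and [P] and [Q] are the morphism groups between these two pairs. So
the ring axioms of [R'] and the bimodule axioms of [P] and [Q] are instances of
the category axioms.

In any preadditive category the morphism groups between objects [p] and [q]
define a Morita equivalence of their endomorphism rings as soon as the identity
of [p] is a sum of composites [p -> q -> p] and that of [q] a sum of composites
[q -> p -> q] ([factors_morita]): the composites form an ideal, and this ideal
contains [1]. In the matrix category it is enough to check this on diagonal
entries ([factors_id_mx]). The entry [f] is common to both pairs, and for [e] and
[S] the condition says that [1] is in the image of [zeta] and of [theta]. *)

(** * Morita equivalences from preadditive categories *)

(** The order of composition is that of matrix indices: [mor i j] is the group of
entries in row [i] and column [j]. *)
Record preadditive (I : Type) := Preadditive {
  mor : I -> I -> zmodType;
  mcomp : forall i j k, mor i j -> mor j k -> mor i k;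
  idm : forall i, mor i i;
  mcompDl : forall i j k (v : mor j k),
    {morph (fun u : mor i j => mcomp u v) : u u' / u + u'};
  mcompDr : forall i j k (u : mor i j),
    {morph (fun v : mor j k => mcomp u v) : v v' / v + v'};
  mcompA : forall i j k l (u : mor i j) (v : mor j k) (w : mor k l),
    mcomp u (mcomp v w) = mcomp (mcomp u v) w;
  mcomp1l : forall i j (u : mor i j), mcomp (idm i) u = u;
  mcomp1r : forall i j (u : mor i j), mcomp u (idm j) = u }.

Arguments idm {I} p i.

Section Endomorphisms.
Variables (I : Type) (C : preadditive I).
Implicit Types (i j p q : I).

Lemma mcomp0l i j k (v : mor C j k) : mcomp (0 : mor C i j) v = 0.
Proof. exact: (morph_add0 (mcompDl v)). Qed.

Lemma mcomp0r i j k (u : mor C i j) : mcomp u (0 : mor C j k) = 0.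
Proof. exact: (morph_add0 (mcompDr u)). Qed.

Lemma end_ring_axioms q : ring_axioms (idm C q) (@mcomp _ C q q q).
Proof.
split; [exact: mcompA | exact: mcomp1l | exact: mcomp1r | |].
  by move=> u v w; apply: mcompDl.
exact: mcompDr.
Qed.

Definition factors p q (x : mor C p p) : Prop :=
  exists s : seq (mor C p q * mor C q p), x = \sum_(uv <- s) mcomp uv.1 uv.2.

Lemma factorsD p q (x y : mor C p p) :
  factors q x -> factors q y -> factors q (x + y).
Proof. by move: x y => _ _ [s ->] [t ->]; exists (s ++ t); rewrite big_cat. Qed.

Lemma factors_mcomp p q (u : mor C p q) (v : mor C q p) : factors q (mcomp u v).
Proof. by exists [:: (u, v)]; rewrite big_seq1. Qed.

Lemma factors_id p : factors p (idm C p).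
Proof. by rewrite -[idm C p]mcomp1l; apply: factors_mcomp. Qed.

(** A ring is seldom literally an endomorphism ring: [R] is one only through its
Peirce decomposition. Hence the statements below are about a ring with an
isomorphism to an endomorphism ring. *)
Record end_iso (A : pzRingType) p := EndIso {
  to_end : A -> mor C p p;
  of_end : mor C p p -> A;
  to_endK : cancel to_end of_end;
  of_endK : cancel of_end to_end;
  to_endD : {morph to_end : a b / a + b};
  to_endM : forall a b, to_end (a * b) = mcomp (to_end a) (to_end b);
  to_end1 : to_end 1 = idm C p }.

Definition end_iso_id p :
    end_iso (ring_of (end_ring_axioms p)) p :=
  @EndIso (ring_of (end_ring_axioms p)) p idfun idfun
    (fun=> erefl) (fun=> erefl) (fun _ _ => erefl) (fun _ _ => erefl) erefl.

Lemma of_endD A p (f : end_iso A p) : {morph of_end f : x y / x + y}.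
Proof.
move=> x y; apply: (can_inj (to_endK f)).
by rewrite to_endD !of_endK.
Qed.

Lemma of_endM A p (f : end_iso A p) x y :
  of_end f (mcomp x y) = of_end f x * of_end f y.
Proof.
apply: (can_inj (to_endK f)).
by rewrite to_endM !of_endK.
Qed.

Section HomBimodule.
Variables (A B : pzRingType) (p q : I) (f : end_iso A p) (g : end_iso B q).

Lemma hom_bimodule_axioms : @bimodule_axioms A B (mor C p q)
  (fun a u => mcomp (to_end f a) u) (fun u b => mcomp u (to_end g b)).
Proof.
split; last by move=> a v b; rewrite mcompA.
  split=> [a|v a b|a b v|v]; [exact: mcompDr | | |].
  - by rewrite to_endD mcompDl.
  - by rewrite to_endM mcompA.
  - by rewrite to_end1 mcomp1l.
split=> [b|v a b|v a b|v]; [exact: mcompDl | | |].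
- by rewrite to_endD mcompDr.
- by rewrite to_endM mcompA.
- by rewrite to_end1 mcomp1r.
Qed.

End HomBimodule.

Section CompMap.
Variables (A B : pzRingType) (p q : I) (f : end_iso A p) (g : end_iso B q).
Local Notation U := (bimod_of (hom_bimodule_axioms f g)).
Local Notation V := (bimod_of (hom_bimodule_axioms g f)).

Definition comp_tensor : tensor U V -> A :=
  @tlift A B A U V A (fun u v => of_end f (mcomp u v)).

Lemma balanced_comp :
  @balanced A B A U V A (fun u v => of_end f (mcomp u v)).
Proof.
split=> [v u u'|u v v'|u b v]; rewrite -1?of_endD; congr (of_end f _).
- exact: mcompDl.
- exact: mcompDr.
- by symmetry; apply: mcompA.
Qed.

Lemma comp_tensorE (u : U) (v : V) :
  comp_tensor (u ⊗ v) = of_end f (mcomp u v).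
Proof. exact: (tlift_tens balanced_comp). Qed.

Lemma comp_tensorD : {morph comp_tensor : s t / s + t}.
Proof. exact: (tliftD balanced_comp). Qed.

Lemma comp_tensor_lact (a : A) t : comp_tensor (a *> t) = a * comp_tensor t.
Proof.
elim/tensor_ind: t => [u v|s t hs ht]; last first.
  by rewrite lactDr !comp_tensorD hs ht mulrDr.
rewrite lact_tens !comp_tensorE -{2}[a](to_endK f) -of_endM.
by congr (of_end f _); symmetry; apply: mcompA.
Qed.

Lemma comp_tensor_ract t (a : A) : comp_tensor (t <* a) = comp_tensor t * a.
Proof.
elim/tensor_ind: t => [u v|s t hs ht]; last first.
  by rewrite ractDl !comp_tensorD hs ht mulrDl.
rewrite ract_tens !comp_tensorE -{2}[a](to_endK f) -of_endM.
by congr (of_end f _); apply: mcompA.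
Qed.

Lemma comp_tensor_hom : is_bimod_hom (comp_tensor : tensor U V -> A^o).
Proof.
split; [exact: comp_tensorD | exact: comp_tensor_lact |].
exact: comp_tensor_ract.
Qed.

(** The image of [comp_tensor] is an ideal of [A], so it is all of [A] once it
contains [1]. *)
Lemma comp_tensor_surj : factors q (idm C p) -> surjective comp_tensor.
Proof.
case=> s s1 a.
exists (a *> (\sum_(uv <- s) (uv.1 : U) ⊗ (uv.2 : V))).
rewrite comp_tensor_lact (big_morph _ comp_tensorD (id1 := 0)); last first.
  exact: morph_add0 comp_tensorD.
under eq_bigr do rewrite comp_tensorE.
rewrite -(big_morph _ (of_endD f) (morph_add0 (of_endD f))) -s1.
by rewrite -(to_end1 f) to_endK mulr1.
Qed.

End CompMap.

Arguments comp_tensor {A B p q} f g t.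

(** Once both maps are composition, the two identities of a Morita context are
associativity of composition. *)
Theorem factors_morita (A B : pzRingType) p q
    (f : end_iso A p) (g : end_iso B q) :
    factors q (idm C p) -> factors p (idm C q) ->
  morita_equivalence (bimod_of (hom_bimodule_axioms f g))
                     (bimod_of (hom_bimodule_axioms g f)).
Proof.
move=> fp fq; exists (comp_tensor f g), (comp_tensor g f); split.
- split; try exact: comp_tensor_hom.
  + move=> u v u'; rewrite !comp_tensorE.
    rewrite -[_ *> _]/(mcomp (to_end f _) _) -[_ <* _]/(mcomp _ (to_end g _)).
    by rewrite !of_endK mcompA.
  + move=> v u v'; rewrite !comp_tensorE.
    rewrite -[_ *> _]/(mcomp (to_end g _) _) -[_ <* _]/(mcomp _ (to_end f _)).
    by rewrite !of_endK mcompA.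
- exact: comp_tensor_surj.
exact: comp_tensor_surj.
Qed.

End Endomorphisms.

(** * Block matrices over a preadditive category *)

Section Matrices.
Variables (I : Type) (C : preadditive I).
Implicit Types (p q r : I * I).

Definition mor_mx p q : zmodType :=
  mx2 (mor C p.1 q.1) (mor C p.1 q.2) (mor C p.2 q.1) (mor C p.2 q.2).

Definition mcomp_mx p q r (u : mor_mx p q) (v : mor_mx q r) : mor_mx p r :=
  Mx2 (mcomp (m11 u) (m11 v) + mcomp (m12 u) (m21 v))
      (mcomp (m11 u) (m12 v) + mcomp (m12 u) (m22 v))
      (mcomp (m21 u) (m11 v) + mcomp (m22 u) (m21 v))
      (mcomp (m21 u) (m12 v) + mcomp (m22 u) (m22 v)).

Definition id_mx p : mor_mx p p := Mx2 (idm C p.1) 0 0 (idm C p.2).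

Lemma mcomp_mxDl p q r (v : mor_mx q r) :
  {morph (fun u : mor_mx p q => mcomp_mx u v) : u u' / u + u'}.
Proof.
by move=> u u'; congr Mx2; rewrite !mcompDl addrACA.
Qed.

Lemma mcomp_mxDr p q r (u : mor_mx p q) :
  {morph (fun v : mor_mx q r => mcomp_mx u v) : v v' / v + v'}.
Proof.
by move=> v v'; congr Mx2; rewrite !mcompDr addrACA.
Qed.

Lemma mcomp_mxA p q r s (u : mor_mx p q) (v : mor_mx q r) (w : mor_mx r s) :
  mcomp_mx u (mcomp_mx v w) = mcomp_mx (mcomp_mx u v) w.
Proof. by congr Mx2; rewrite !mcompDl !mcompDr !mcompA addrACA. Qed.

Lemma mcomp_mx1l p q (u : mor_mx p q) : mcomp_mx (id_mx p) u = u.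
Proof.
case: u => [[a b] [c d]].
by congr Mx2; rewrite !mcomp1l !mcomp0l ?addr0 ?add0r.
Qed.

Lemma mcomp_mx1r p q (u : mor_mx p q) : mcomp_mx u (id_mx q) = u.
Proof.
case: u => [[a b] [c d]].
by congr Mx2; rewrite !mcomp1r !mcomp0r ?addr0 ?add0r.
Qed.

Definition matrices : preadditive (I * I) :=
  Preadditive mcomp_mxDl mcomp_mxDr mcomp_mxA mcomp_mx1l mcomp_mx1r.

(** The identity of [p] is the sum of its two diagonal blocks, and a composite
in the category becomes a composite of matrices with one diagonal block. *)
Lemma factors_id_mx (p q : I * I) :
    factors q.1 (idm C p.1) -> factors q.2 (idm C p.2) ->
  factors q (idm matrices p).
Proof.
move=> [s s1] [t t1].
have -> : idm matrices p = Mx2 (idm C p.1) 0 0 0 + Mx2 0 0 0 (idm C p.2).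
  by congr Mx2; rewrite ?addr0 ?add0r.
apply: factorsD.
  exists [seq (Mx2 uv.1 0 0 0 : mor_mx p q,
               Mx2 uv.2 0 0 0 : mor_mx q p) | uv <- s].
  rewrite s1 big_map; elim: s {s1} => [|uv s IHs]; first by rewrite !big_nil.
  rewrite !big_cons -{}IHs.
  by congr Mx2; rewrite /= !(mcomp0l, mcomp0r) !(addr0, add0r).
exists [seq (Mx2 0 0 0 uv.1 : mor_mx p q,
             Mx2 0 0 0 uv.2 : mor_mx q p) | uv <- t].
rewrite t1 big_map; elim: t {t1} => [|uv t IHt]; first by rewrite !big_nil.
rewrite !big_cons -{}IHt.
by congr Mx2; rewrite /= !(mcomp0l, mcomp0r) !(addr0, add0r).
Qed.

End Matrices.

(** * The Peirce decomposition as a ring isomorphism *)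

Section PeirceMatrix.
Variables (R : pzRingType) (e : idem R).
Local Notation f := (idemC e).

Lemma addr_idemC : idem_val f + idem_val e = 1.
Proof. exact: subrK. Qed.

Lemma idemC_mul0 : idem_val f * idem_val e = 0.
Proof. by rewrite mulrBl mul1r idemM subrr. Qed.

Lemma idem_mulC0 : idem_val e * idem_val f = 0.
Proof. by rewrite mulrBr mulr1 idemM subrr. Qed.

Lemma peirce_of_val (g h : idem R) (x : peirce g h) :
  peirce_of g h (val x) = x.
Proof. by apply: val_inj; rewrite /= peirceK. Qed.

Lemma peirce_of_orthl (g g' h h' : idem R) (x : peirce g h) :
  idem_val g' * idem_val g = 0 -> peirce_of g' h' (val x) = 0.
Proof.
by move=> g0; apply: val_inj; rewrite /= -(peirceK x) !mulrA g0 !mul0r.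
Qed.

Lemma peirce_of_orthr (g g' h h' : idem R) (x : peirce g h) :
  idem_val h * idem_val h' = 0 -> peirce_of g' h' (val x) = 0.
Proof.
by move=> h0; apply: val_inj; rewrite /= -(peirceK x) -!mulrA h0 !mulr0.
Qed.

Lemma peirce_ofD (g h : idem R) : {morph peirce_of g h : r s / r + s}.
Proof. by move=> r s; apply: val_inj; rewrite /= mulrDr mulrDl. Qed.

(** Insert [1 = f + e] between the two factors. *)
Lemma peirce_ofM (g h : idem R) r s : peirce_of g h (r * s) =
  peirce_of g f r ** peirce_of f h s + peirce_of g e r ** peirce_of e h s.
Proof.
have midK (k : idem R) :
    idem_val g * r * idem_val k * (idem_val k * s * idem_val h)
      = idem_val g * r * (idem_val k * (s * idem_val h)).
  by rewrite -!mulrA [idem_val k * (_ * _)]mulrA idemM.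
apply: val_inj.
rewrite -[RHS]/(idem_val g * r * idem_val f * (idem_val f * s * idem_val h)
  + idem_val g * r * idem_val e * (idem_val e * s * idem_val h)).
rewrite !midK -mulrDr -mulrDl addr_idemC mul1r.
by rewrite /= !mulrA.
Qed.

Definition of_peirce_mx (a : mx2 (peirce f f) (peirce f e)
    (peirce e f) (peirce e e)) : R :=
  val (m11 a) + val (m12 a) + (val (m21 a) + val (m22 a)).

Lemma peirce_mxK : cancel (peirce_mx e) of_peirce_mx.
Proof.
move=> r.
rewrite -[LHS]/(idem_val f * r * idem_val f + idem_val f * r * idem_val e
  + (idem_val e * r * idem_val f + idem_val e * r * idem_val e)).
by rewrite -!mulrDr addr_idemC !mulr1 -mulrDl addr_idemC mul1r.
Qed.

Lemma of_peirce_mxK : cancel of_peirce_mx (peirce_mx e).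
Proof.
case=> [[a b] [c d]]; rewrite /of_peirce_mx /peirce_mx.
have fe := idemC_mul0; have ef := idem_mulC0.
by congr Mx2; rewrite !peirce_ofD peirce_of_val
  !(peirce_of_orthl _ _ fe, peirce_of_orthl _ _ ef,
    peirce_of_orthr _ _ fe, peirce_of_orthr _ _ ef) ?add0r ?addr0.
Qed.

Lemma peirce_mx1 : peirce_mx e 1 = Mx2 (peirce_one f) 0 0 (peirce_one e).
Proof.
by congr Mx2; apply: val_inj; rewrite [LHS]/= mulr1 ?idemC_mul0 ?idem_mulC0.
Qed.

End PeirceMatrix.

(** * The category of the three corners *)

(** The objects stand for [1 - e], [e] and [S]. *)
Inductive corner := cF | cE | cS.

Lemma tensor_sum (A B C : pzRingType) (U : bimodType A B) (V : bimodType B C)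
    (t : tensor U V) : exists s : seq (U * V), t = \sum_(uv <- s) uv.1 ⊗ uv.2.
Proof.
elim/tensor_ind: t => [u v|_ _ [s ->] [t ->]].
  by exists [:: (u, v)]; rewrite big_seq1.
by exists (s ++ t); rewrite big_cat.
Qed.

Section Corners.
Variables (R S : pzRingType) (e : idem R).
Variables (M : bimodType (peirce e e) S) (N : bimodType S (peirce e e)).
Variables (zeta : tensor M N -> peirce e e) (theta : tensor N M -> S).
Hypothesis hctx : morita_context zeta theta.
Local Notation f := (idemC e).

Definition corner_mor (i j : corner) : zmodType :=
  match i, j with
  | cF, cF => peirce f f
  | cF, cE => peirce f e
  | cF, cS => tensor (peirce f e) M
  | cE, cF => peirce e f
  | cE, cE => peirce e e
  | cE, cS => M
  | cS, cF => tensor N (peirce e f)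
  | cS, cE => N
  | cS, cS => S
  end.

(** Each composite is written with the very operation that defines the
corresponding entry of a product in [R'], [Pmx] or [Qmx]; then these products
are matrix products over [corners] by conversion. *)
Definition corner_comp (i j k : corner) :
    corner_mor i j -> corner_mor j k -> corner_mor i k :=
  match i, j, k with
  | cF, cF, cF => fun a b => a ** b
  | cF, cF, cE => fun a b => a ** b
  | cF, cF, cS => fun a b => a *> b
  | cF, cE, cF => fun a b => a ** b
  | cF, cE, cE => fun a b => a ** b
  | cF, cE, cS => fun a b => a ⊗ b
  | cF, cS, cF => mul_xm_ny zeta
  | cF, cS, cE => mul_xm_n zeta
  | cF, cS, cS => fun a b => a <* b
  | cE, cF, cF => fun a b => a ** b
  | cE, cF, cE => fun a b => a ** b
  | cE, cF, cS => @mul_y_xm R S e M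
  | cE, cE, cF => fun a b => a ** b
  | cE, cE, cE => fun a b => a ** b
  | cE, cE, cS => fun a b => a *> b
  | cE, cS, cF => mul_m_ny zeta
  | cE, cS, cE => fun a b => zeta (a ⊗ b)
  | cE, cS, cS => fun a b => a <* b
  | cS, cF, cF => fun a b => a <* b
  | cS, cF, cE => @mul_ny_x R S e N
  | cS, cF, cS => mul_ny_xm theta
  | cS, cE, cF => fun a b => a ⊗ b
  | cS, cE, cE => fun a b => a <* b
  | cS, cE, cS => fun a b => theta (a ⊗ b)
  | cS, cS, cF => fun a b => a *> b
  | cS, cS, cE => fun a b => a *> b
  | cS, cS, cS => fun a b => a * b
  end.

Definition corner_id (i : corner) : corner_mor i i :=
  match i with cF => 1 | cE => 1 | cS => 1 end.

Let zetaD : {morph zeta : s t / s + t} := bimod_homD (morita_zeta hctx).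
Let thetaD : {morph theta : s t / s + t} := bimod_homD (morita_theta hctx).

(** The products that are defined by lifting in one variable are additive in the
other variable too; on pure tensors this is visible. *)
Lemma mul_m_nyDl t : {morph (fun m : M => mul_m_ny zeta m t) : m m' / m + m'}.
Proof.
move=> m m'; elim/tensor_ind: t => [n y|s t hs ht].
  by rewrite !(mul_m_nyE hctx) tensDl zetaD peirce_mulDl.
by rewrite !(mul_m_nyDr hctx) hs ht addrACA.
Qed.

Lemma mul_y_xmDl (s : tensor (peirce f e) M) :
  {morph (fun y : peirce e f => mul_y_xm y s) : y y' / y + y'}.
Proof.
move=> y y'; elim/tensor_ind: s => [x m|s t hs ht].
  by rewrite !mul_y_xmE peirce_mulDl lactDl.
by rewrite !mul_y_xmDr hs ht addrACA.
Qed.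

Lemma mul_xm_nDr s : {morph mul_xm_n zeta s : n n' / n + n'}.
Proof.
move=> n n'; elim/tensor_ind: s => [x m|s t hs ht].
  by rewrite !(mul_xm_nE hctx) tensDr zetaD peirce_mulDr.
by rewrite !(mul_xm_nDl hctx) hs ht addrACA.
Qed.

Lemma mul_ny_xDr (t : tensor N (peirce e f)) :
  {morph mul_ny_x t : x x' / x + x'}.
Proof.
move=> x x'; elim/tensor_ind: t => [n y|s t hs ht].
  by rewrite !mul_ny_xE peirce_mulDr ractDr.
by rewrite !mul_ny_xDl hs ht addrACA.
Qed.

Lemma corner_compDl i j k (v : corner_mor j k) :
  {morph (fun u : corner_mor i j => corner_comp u v) : u u' / u + u'}.
Proof.
case: i j k v => [] [] [] /= v u u'; do ?[exact: peirce_mulDl |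
  exact: (lactDl v) | exact: (ractDl v) | exact: tensDl].
- exact: (mul_xm_nyDl hctx).
- exact: (mul_xm_nDl hctx).
- exact: mul_y_xmDl.
- exact: mul_m_nyDl.
- by rewrite tensDl zetaD.
- exact: mul_ny_xDl.
- exact: (mul_ny_xmDl hctx).
- by rewrite tensDl thetaD.
- exact: mulrDl.
Qed.

Lemma corner_compDr i j k (u : corner_mor i j) :
  {morph (fun v : corner_mor j k => corner_comp u v) : v v' / v + v'}.
Proof.
case: i j k u => [] [] [] /= u v v'; do ?[exact: peirce_mulDr |
  exact: (lactDr u) | exact: (ractDr u) | exact: tensDr].
- exact: (mul_xm_nyDr hctx).
- exact: mul_xm_nDr.
- exact: mul_y_xmDr.
- exact: (mul_m_nyDr hctx).
- by rewrite tensDr zetaD.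
- exact: mul_ny_xDr.
- exact: (mul_ny_xmDr hctx).
- by rewrite tensDr thetaD.
- exact: mulrDr.
Qed.

Lemma corner_comp1l i j (u : corner_mor i j) :
  corner_comp (corner_id i) u = u.
Proof.
by case: i j u => [] [] /= u;
  do ?[exact: peirce_mul1l | exact: lact1 | exact: mul1r].
Qed.

Lemma corner_comp1r i j (u : corner_mor i j) :
  corner_comp u (corner_id j) = u.
Proof.
by case: i j u => [] [] /= u;
  do ?[exact: peirce_mul1r | exact: ract1 | exact: mulr1].
Qed.

(** The generators of a morphism group: pure tensors where the group is a tensor
product, all elements elsewhere. *)
Definition pure i j : corner_mor i j -> Prop :=
  match i, j with
  | cF, cS => fun s => exists (x : peirce f e) (m : M), s = x ⊗ m
  | cS, cF => fun t => exists (n : N) (y : peirce e f), t = n ⊗ y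
  | _, _ => fun _ => True
  end.

Lemma pure_ind i j (P : corner_mor i j -> Prop) :
  (forall u, pure u -> P u) -> (forall u v, P u -> P v -> P (u + v)) ->
  forall u, P u.
Proof.
case: i j P => [] [] P /= Pp PD u; do ?[exact: Pp].
  by elim/tensor_ind: u => // x m; apply: Pp; exists x, m.
by elim/tensor_ind: u => // n y; apply: Pp; exists n, y.
Qed.

(* The rules below are oriented so that they bring both bracketings of a product
   of three generators to one normal form: scalars from [eRe] move next to [X]
   and [Y] in a tensor and are collected into one scalar when they act, scalars
   from [S] are applied one at a time, and every [theta] that acts becomes a
   [zeta]. *)
Let lact_peirce (g h : idem R) (a : peirce g g) (x : peirce g h) :
  a *> x = a ** x.
Proof. by []. Qed.
Let ract_peirce (g h : idem R) (x : peirce g h) (a : peirce h h) :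
  x <* a = x ** a.
Proof. by []. Qed.
Let mul_peirce (g : idem R) (x a : peirce g g) : x * a = x ** a.
Proof. by []. Qed.
Let lactM (a b : peirce e e) (m : M) : a *> (b *> m) = (a ** b) *> m.
Proof. by rewrite -lactA. Qed.
Let ractM (a b : peirce e e) (n : N) : n <* a <* b = n <* (a ** b).
Proof. by rewrite -ractA. Qed.
Let zetal (a : peirce e e) m n : zeta ((a *> m) ⊗ n) = a ** zeta (m ⊗ n).
Proof. by rewrite -lact_tens; apply: (bimod_homl (morita_zeta hctx)). Qed.
Let zetar m n (a : peirce e e) : zeta (m ⊗ (n <* a)) = zeta (m ⊗ n) ** a.
Proof. by rewrite -ract_tens; apply: (bimod_homr (morita_zeta hctx)). Qed.
Let thetal (s : S) n m : theta ((s *> n) ⊗ m) = s * theta (n ⊗ m).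
Proof. by rewrite -lact_tens; apply: (bimod_homl (morita_theta hctx)). Qed.
Let thetar n m (s : S) : theta (n ⊗ (m <* s)) = theta (n ⊗ m) * s.
Proof. by rewrite -ract_tens; apply: (bimod_homr (morita_theta hctx)). Qed.

Let tensA_x x (a : peirce e e) (m : M) :
  (x : peirce f e) ⊗ (a *> m) = (x ** a) ⊗ m.
Proof. by rewrite -tensA. Qed.
Let tensA_y (n : N) (a : peirce e e) (y : peirce e f) :
  (n <* a) ⊗ y = n ⊗ (a ** y).
Proof. by rewrite tensA. Qed.
Let lactMS (s t : S) (n : N) : (s * t) *> n = s *> (t *> n).
Proof. exact: lactA. Qed.
Let ractMS (m : M) (s t : S) : m <* (s * t) = m <* s <* t.
Proof. exact: ractA. Qed.
Let zetaA m (s : S) n : zeta ((m <* s) ⊗ n) = zeta (m ⊗ (s *> n)).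
Proof. by rewrite tensA. Qed.
Let thetaA n (a : peirce e e) m : theta ((n <* a) ⊗ m) = theta (n ⊗ (a *> m)).
Proof. by rewrite tensA. Qed.
Let ract_theta m n m' : m <* theta (n ⊗ m') = zeta (m ⊗ n) *> m'.
Proof. by rewrite (morita_zetaA hctx). Qed.
Let lact_theta n m n' : theta (n ⊗ m) *> n' = n <* zeta (m ⊗ n').
Proof. by rewrite (morita_thetaA hctx). Qed.

Let pureE := (mul_xm_nyE hctx, mul_ny_xmE hctx, mul_m_nyE hctx,
  mul_xm_nE hctx, mul_y_xmE, @mul_ny_xE R S e N, lact_tens, ract_tens).
Let actE := (lact_peirce, ract_peirce, mul_peirce).
Let ctxE := (zetal, zetar, thetal, thetar, zetaA, thetaA,
  ract_theta, lact_theta).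
Let assocE := (lactM, ractM, lactMS, ractMS, lractA, tensA_x, tensA_y,
  peirce_mulA, mulrA).

(** Both sides are additive in each of the three arguments, so generators
suffice. The 81 cases are then words in [R], [M], [N], [S], [zeta] and [theta],
and they are compared by their normal forms. *)
Lemma corner_compA i j k l (u : corner_mor i j) (v : corner_mor j k)
    (w : corner_mor k l) :
  corner_comp u (corner_comp v w) = corner_comp (corner_comp u v) w.
Proof.
elim/pure_ind: u => [u pu|u u' hu hu']; last by rewrite !corner_compDl hu hu'.
elim/pure_ind: v => [v pv|v v' hv hv'].
  elim/pure_ind: w => [w pw|w w' hw hw']; last by rewrite !corner_compDr hw hw'.
  case: i j k l u v w pu pv pw => [] [] [] [] u v w /=;
    do 3![case=> [? [? ->]] | move=> _];
    by rewrite ?pureE ?actE ?(ctxE, assocE).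
rewrite corner_compDr [in RHS]corner_compDl [in LHS](corner_compDl w).
by rewrite corner_compDr hv hv'.
Qed.

Definition corners : preadditive corner :=
  Preadditive corner_compDl corner_compDr corner_compA corner_comp1l
    corner_comp1r.

(* Transparent, so that the action of [R] through it unfolds to [Pmx_lact] and
   [Qmx_ract]. *)
Definition peirce_end_iso : end_iso (matrices corners) R (cF, cE).
Proof.
apply: (@EndIso _ (matrices corners) R (cF, cE) (peirce_mx e)
  (@of_peirce_mx R e)).
- exact: peirce_mxK.
- exact: of_peirce_mxK.
- by move=> r s; congr Mx2; apply: peirce_ofD.
- by move=> r s; congr Mx2; apply: peirce_ofM.
exact: peirce_mx1.
Defined.

Lemma factors_idE : surjective zeta -> factors cS (idm corners cE).
Proof.
move=> zs; have [t t1] := zs 1; have [s ts] := tensor_sum t.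
exists s; rewrite [LHS](esym t1) ts.
exact: (big_morph _ zetaD (morph_add0 zetaD)).
Qed.

Lemma factors_idS : surjective theta -> factors cE (idm corners cS).
Proof.
move=> ts; have [t t1] := ts 1; have [s tE] := tensor_sum t.
exists s; rewrite [LHS](esym t1) tE.
exact: (big_morph _ thetaD (morph_add0 thetaD)).
Qed.

End Corners.

Theorem proposition1p1 (R S : pzRingType) (e : idem R)
    (M : bimodType (peirce e e) S) (N : bimodType S (peirce e e))
    (zeta : tensor M N -> peirce e e) (theta : tensor N M -> S)
    (hctx : morita_context zeta theta)
    (hzeta : surjective zeta) (htheta : surjective theta) :
  exists hR : ring_axioms (Rprime_one M N) (Rprime_mul zeta theta),
  let R' : pzRingType := ring_of hR in
  exists (hP : @bimodule_axioms R R' (Pmx M)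
                 (@Pmx_lact R S e M) (@Pmx_ract R S e M N zeta))
         (hQ : @bimodule_axioms R' R (Qmx N)
                 (@Qmx_lact R S e M N zeta) (@Qmx_ract R S e N)),
  morita_equivalence (bimod_of hP) (bimod_of hQ).
Proof.
pose D := matrices (corners hctx).
pose hR : ring_axioms (Rprime_one M N) (Rprime_mul zeta theta) :=
  end_ring_axioms D (cF, cS).
exists hR => R'.
pose iR : end_iso D R (cF, cE) := peirce_end_iso hctx.
pose iR' : end_iso D R' (cF, cS) := end_iso_id D (cF, cS).
exists (hom_bimodule_axioms iR iR'), (hom_bimodule_axioms iR' iR).
apply: (factors_morita iR iR').
  by apply: factors_id_mx; [exact: factors_id | exact: factors_idE].
by apply: factors_id_mx; [exact: factors_id | exact: factors_idS].
Qed.
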